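(* Let $X$ be a real Banach space, $g:[a,b]\to X$, $x\in[a,b]$, and suppose that $g$ is metrically differentiable at $x$ with $md(g,x)>0$, and that $md(g,\cdot)$ is continuous at $x$. Then $x$ is a bilaterally metrically regular point of the function $g$.
   Context: For $g:[a,b]\to X$, the unilateral metric derivatives are $md_{\pm}(g,x)=\lim_{t\to0+}\frac{\|g(x\pm t)-g(x)\|}{t}$. If both exist and are equal (and finite), their common value is the metric derivative $md(g,x)$; at an endpoint of $[a,b]$ only the one-sided limit taken inside $[a,b]$ is used. ''$md(g,\cdot)$ is continuous at $x$'' means that $md(g,s)$ exists for all $s\in[a,b]$ in some neighbourhood of $x$ and $md(g,s)\to md(g,x)$ as $s\to x$, $s\in[a,b]$. The mapping $g$ is metrically differentiable at $x$ if $md(g,x)$ exists and $\|g(y)-g(z)\|-md(g,x)|y-z|=o(|y-x|+|z-x|)$ as $(y,z)\to(x,x)$ with $y,z\in[a,b]$. $\bigvee_y^z g$ denotes the total variation of $g$ on $[y,z]$. A point $x\in[a,b]$ is a bilaterally metrically regular point of $g$ if $\frac{\|g(y)-g(z)\|}{\bigvee_y^z g}\to1$ as $(y,z)\to(x,x)$ with $a\le y\le x\le z\le b$, $(y,z)\ne(x,x)$ (in particular the denominator is nonzero for all such $(y,z)$ close to $(x,x)$). *)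

(* Defs.v *)
From HB Require Import structures.
From mathcomp Require Import all_boot all_order all_algebra.
From mathcomp Require Import all_classical all_reals all_analysis.

Set Implicit Arguments.
Unset Strict Implicit.
Unset Printing Implicit Defensive.

Import Order.TTheory GRing.Theory Num.Theory.
Import numFieldNormedType.Exports.

Local Open Scope classical_set_scope.
Local Open Scope ring_scope.

(* A mapping [a, b] -> X is a total function R -> X; no notion below depends  *)
(* on its values outside [a, b] when a < b and the points lie in [a, b].      *)

Section metric_derivative.
Context {R : realType} {X : normedModType R}.
Implicit Types (a b x : R) (g : R -> X).

Definition mdquot_right g x (t : R) : R := `|g (x + t) - g x| / t.
Definition mdquot_left g x (t : R) : R := `|g (x - t) - g x| / t.

Definition md_right g x : R := lim (mdquot_right g x t @[t --> 0^'+]).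
Definition md_left g x : R := lim (mdquot_left g x t @[t --> 0^'+]).

Definition md_exists a b g x : Prop :=
  [/\ x < b -> cvg (mdquot_right g x t @[t --> 0^'+]),
      a < x -> cvg (mdquot_left g x t @[t --> 0^'+]) &
      a < x < b -> md_right g x = md_left g x].

(* Meaningful under md_exists a b g x, as lim is. *)
Definition md a b g x : R := if x < b then md_right g x else md_left g x.

Definition md_continuous_at a b g x : Prop :=
  (\forall s \near within `[a, b] (nbhs x), md_exists a b g s) /\
  md a b g s @[s --> within `[a, b] (nbhs x)] --> md a b g x.

Definition metrically_differentiable a b g x : Prop :=
  let F := within (`[a, b] `*` `[a, b]) (nbhs (x, x)) in
  md_exists a b g x /\
  (fun p : R * R => `|g p.1 - g p.2| - md a b g x * `|p.1 - p.2| : R^o)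
    =o_F (fun p : R * R => `|p.1 - x| + `|p.2 - x| : R^o).

End metric_derivative.

(* The library's variation and total_variation are for real-valued functions  *)
(* only; these are their definitions with the norm of X.                      *)
Section norm_variation.
Context {R : realType} {X : normedModType R}.
Implicit Types (y z : R) (g : R -> X).

Definition norm_variation y z g (s : seq R) : R :=
  let G := g \o nth z (y :: s) in
  \sum_(0 <= n < size s) `|G n.+1 - G n|.

Definition norm_total_variation y z g : \bar R :=
  ereal_sup [set (norm_variation y z g s)%:E | s in itv_partition y z].

(* Extended-real quotient: it is 0 when the total variation is +oo. *)
Definition bilaterally_metrically_regular a b g x : Prop :=
  let F := within [set p : R * R |
             [/\ a <= p.1 <= x, x <= p.2 <= b & p <> (x, x)]] (nbhs (x, x)) in
  (\forall p \near F, norm_total_variation p.1 p.2 g != 0%E) /\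
  (`|g p.1 - g p.2|%:E / norm_total_variation p.1 p.2 g)%E @[p --> F] --> 1%E.

End norm_variation.

(* Main.v *)
Require Import Defs.
From mathcomp Require Import all_boot all_order all_algebra.
From mathcomp Require Import all_classical all_reals all_analysis.
From mathcomp Require Import lra.
Import Order.TTheory GRing.Theory Num.Theory.
Import numFieldNormedType.Exports.
Local Open Scope classical_set_scope.
Local Open Scope ring_scope.

(** Write [m = md g x]. Continuity of the metric derivative at [x] gives
    [md g s < m + e] near [x], and a mean value inequality turns this into
    [|g u - g v| <= (m + e) |u - v|] near [x], so that the variation of [g] on
    [[y, z]] is at most [(m + e) (z - y)]. For [y <= x <= z] one has
    [|y - x| + |z - x| = z - y], so metric differentiability gives
    [|g y - g z| >= (m - e) (z - y)]. As the variation is at least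
    [|g y - g z|], the ratio lies between [(m - e) / (m + e)] and [1]. *)

Section mean_value.
Context {R : realType} {X : normedModType R}.
Implicit Types (a b c u v x y z L : R) (g : R -> X).

Lemma mdquot_right_lt g c L :
  cvg (mdquot_right g c t @[t --> 0^'+]) -> md_right g c < L ->
  \forall t \near 0^'+, `|g (c + t) - g c| <= L * t.
Proof.
move=> gc gL; near=> t.
have t0 : 0 < t by near: t; exact: nbhs_right_gt.
rewrite -ler_pdivrMr// ltW//.
by near: t; exact: cvgr_lt gc _ gL.
Unshelve. all: by end_near. Qed.

Lemma mdquot_left_lt g c L :
  cvg (mdquot_left g c t @[t --> 0^'+]) -> md_left g c < L ->
  \forall t \near 0^'+, `|g (c - t) - g c| <= L * t.
Proof.
move=> gc gL; near=> t.
have t0 : 0 < t by near: t; exact: nbhs_right_gt.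
rewrite -ler_pdivrMr// ltW//.
by near: t; exact: cvgr_lt gc _ gL.
Unshelve. all: by end_near. Qed.

(** [md] selects the right derivative when [c < b], where [md_exists] makes the two sides agree; at
    [c = b] it is the left derivative by definition. *)
Lemma md_exists_leftE a b g c : a < c -> c <= b -> md_exists a b g c ->
  md a b g c = md_left g c.
Proof.
move=> ac cb [_ _ gE]; rewrite /md; case: ifPn => // c_b.
by rewrite gE// ac.
Qed.

(* The supremum [c] of the points [t] with [|g t - g u| <= L (t - u)] is such
   a point by the bound on the left derivative at [c], and it can only be [v]
   by the bound on the right derivative. *)
Lemma md_mean_value a b g u v L : a <= u -> u <= v -> v <= b ->
  (forall s, u <= s <= v -> md_exists a b g s /\ md a b g s < L) ->
  `|g v - g u| <= L * (v - u).
Proof.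
move=> au uv vb gL.
pose S := [set t | u <= t <= v /\ `|g t - g u| <= L * (t - u)].
have Su : S u by split; rewrite ?lexx// !subrr normr0 mulr0.
have vS : ubound S v by move=> t [/andP[]].
have Ssup : has_sup S by split; [exists u | exists v].
set c := sup S.
have uc : u <= c by exact: sup_upper_bound Ssup _ Su.
have cv : c <= v by apply: ge_sup => //; exists u.
have [gc gcL] : md_exists a b g c /\ md a b g c < L by apply: gL; rewrite uc.
have Sc : S c.
  split; first by rewrite uc.
  have [<-|cu] := eqVneq u c; first by rewrite !subrr normr0 mulr0.
  have ltuc : u < c by rewrite lt_neqAle cu.
  have ac : a < c by exact: le_lt_trans ltuc.
  have gl := md_exists_leftE _ _ _ _ ac (le_trans cv vb) gc.
  case: (gc) => _ /(_ ac) gcl _; rewrite gl in gcL.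
  (* The left bound holds for increments below [e], so a point [t] of [S] closer than that to [c]
     passes its bound on: [L * (c - t) + L * (t - u) = L * (c - u)]. *)
  have /nbhs_ballP[e /= e0 He] := mdquot_left_lt _ _ _ gcl gcL.
  have [t [/andP[ut tv] St] ct] := sup_adherent e0 Ssup.
  have tc : t <= c by apply: sup_upper_bound => //; split; rewrite ?ut.
  have [<-//|nct] := eqVneq t c.
  have lttc : t < c by rewrite lt_neqAle nct.
  have gt : `|g t - g c| <= L * (c - t).
    have := He (c - t); rewrite opprB addrCA subrr addr0; apply.
      rewrite -/c in ct; rewrite /ball/= sub0r normrN gtr0_norm; lra.
    by rewrite subr_gt0.
  rewrite distrC in gt.
  by rewrite (le_trans (ler_distD (g t) _ _))//; lra.
case: Sc => _ Sc.
have [<-//|ncv] := eqVneq c v.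
have ltcv : c < v by rewrite lt_neqAle ncv.
have cb : c < b by exact: lt_le_trans vb.
case: (gc) => /(_ cb) gcr _ _.
have gcL' : md_right g c < L by move: gcL; rewrite /md cb.
(* If [c < v], the triangle inequality through [g c] puts [c + t] in [S] for some [t > 0], against
   the choice of [c]. *)
have : \forall t \near 0^'+, [/\ 0 < t, c + t <= v &
    `|g (c + t) - g c| <= L * t].
  near=> t; split; last by near: t; exact: mdquot_right_lt.
    by near: t; exact: nbhs_right_gt.
  have : t < v - c by near: t; apply: nbhs_right_lt; rewrite subr_gt0.
  lra.
case/filter_ex => t [t0 ctv gt].
have : c + t <= c.
  apply: sup_upper_bound => //; split; first by lra.
  by rewrite (le_trans (ler_distD (g c) _ _))//; lra.
lra.
Unshelve. all: by end_near. Qed.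

Lemma norm_variation_cons y z g t s :
  norm_variation y z g (t :: s) = `|g t - g y| + norm_variation t z g s.
Proof. by rewrite /norm_variation big_nat_recl. Qed.

(** Each increment is at most [L] times its length, and the lengths telescope. The induction varies
    [y], since dropping the first point moves the left endpoint. *)
Lemma norm_variation_lipschitz y z g L s : itv_partition y z s ->
  (forall u v, y <= u -> u <= v -> v <= z -> `|g v - g u| <= L * (v - u)) ->
  norm_variation y z g s <= L * (z - y).
Proof.
elim: s y => [|t s IH] y ys gL.
  by rewrite (itv_partition_nil ys) /norm_variation/= big_nil subrr mulr0.
have ts := itv_partition_cons ys.
have tz := itv_partition_le ts.
have yt : y < t by case: ys => /= /andP[].
rewrite norm_variation_cons.
have := gL _ _ (lexx y) (ltW yt) tz.
have : norm_variation t z g s <= L * (z - t).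
  by apply: IH => // u v tu; apply: gL; rewrite (le_trans (ltW yt)).
lra.
Qed.

Lemma norm_total_variation_lipschitz y z g L :
  (forall u v, y <= u -> u <= v -> v <= z -> `|g v - g u| <= L * (v - u)) ->
  (norm_total_variation y z g <= (L * (z - y))%:E)%E.
Proof.
move=> gL; apply: ge_ereal_sup => _ [s ys <-].
by rewrite lee_fin norm_variation_lipschitz.
Qed.

(** The partition with the single point [z] attains this value; partitions increase strictly, hence
    the strict [y < z]. *)
Lemma dist_le_norm_total_variation y z g : y < z ->
  (`|g y - g z|%:E <= norm_total_variation y z g)%E.
Proof.
move=> yz; apply: ereal_sup_ubound; exists [:: z]; first exact: itv_partition1.
by rewrite norm_variation_cons /norm_variation big_nil addr0 distrC.
Qed.

End mean_value.

Section regularity.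
Context {R : realType} {X : normedModType R}.
Implicit Types (a b x e : R) (g : R -> X).

(** A single neighbourhood of [(x, x)] serves all [u <= v] between [p.1] and [p.2], the uniformity
    that the bound on the variation requires. *)
Lemma md_continuous_lipschitz a b g x e : a <= x <= b -> 0 < e ->
  md_continuous_at a b g x ->
  \forall p \near (x, x), forall u v,
    a <= p.1 -> p.2 <= b -> p.1 <= u -> u <= v -> v <= p.2 ->
    `|g v - g u| <= (md a b g x + e) * (v - u).
Proof.
move=> xab e0 [gx gc].
have : \forall s \near x, s \in `[a, b] ->
    md_exists a b g s /\ md a b g s < md a b g x + e.
  have gL := cvgr_lt _ gc (md a b g x + e).
  have /gL{gL} : md a b g x < md a b g x + e by lra.
  rewrite near_withinE => gL; rewrite near_withinE in gx.
  apply: filterS2 gx gL => s gx gL sab; split; first exact: gx.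
  exact: gL.
move=> /nbhs_ballP[d /= d0 xd].
apply/nbhs_ballP; exists d => //= -[y z] [/= xy xz] u v ay zb yu uv vz.
apply: (md_mean_value a b _ _ _ _ (le_trans ay yu) uv (le_trans vz zb)) =>
  s /andP[us sv].
(* A ball of the line is convex, so it contains every [s] between [y] and [z]. *)
have xs : ball x d s.
  move: xy xz; rewrite /ball/= !ltr_distlC => /andP[? ?] /andP[? ?].
  by apply/andP; split; lra.
by have := xd s xs; apply; rewrite in_itv/=; lra.
Qed.

Lemma md_le_dist a b g x e : 0 < e -> metrically_differentiable a b g x ->
  \forall p \near (x, x), a <= p.1 <= x -> x <= p.2 <= b ->
    (md a b g x - e) * (p.2 - p.1) <= `|g p.1 - g p.2|.
Proof.
move=> e0 [_ /eqoP/(_ _ e0)]; rewrite near_withinE; apply: filterS => -[y z] /=.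
move=> Hyz /andP[ay yx] /andP[xz zb].
have /Hyz : (`[a, b] `*` `[a, b]) (y, z) by split; rewrite /= in_itv/=; lra.
rewrite (@ger0_norm _ (`|_| + `|_|)) ?addr_ge0//.
rewrite ler_norml => /andP[+ _].
rewrite (distrC y z) (@ger0_norm _ (z - y)) ?(@ler0_norm _ (y - x));
  rewrite ?(@ger0_norm _ (z - x)); lra.
Qed.

End regularity.

Theorem lemma5p1 (R : realType) (X : completeNormedModType R) (a b : R)
    (g : R -> X) (x : R) (ab : a < b) (xab : a <= x <= b)
    (gdiff : metrically_differentiable a b g x)
    (gpos : 0 < md a b g x)
    (gcont : md_continuous_at a b g x) :
  bilaterally_metrically_regular a b g x.
Proof.
set m := md a b g x in gpos *.
pose V (p : R * R) := norm_total_variation p.1 p.2 g.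
pose A := [set p : R * R | [/\ a <= p.1 <= x, x <= p.2 <= b & p <> (x, x)]].
(* Here [r] is the variation, now known to be finite, and [D] is the length [p.2 - p.1]; what
   follows is real arithmetic on these bounds. *)
have key e : 0 < e -> e < m -> \forall p \near within A (nbhs (x, x)),
    exists2 r : R, V p = r%:E & exists2 D, 0 < D &
    [/\ (m - e) * D <= `|g p.1 - g p.2|, `|g p.1 - g p.2| <= r
      & r <= (m + e) * D].
  move=> e0 em; rewrite near_withinE.
  have H1 := md_continuous_lipschitz _ _ _ _ _ xab e0 gcont.
  have H2 := md_le_dist _ _ _ _ _ e0 gdiff.
  near=> p => -[apx xpb px].
  have yz : p.1 < p.2.
    rewrite lt_neqAle; apply/andP; split; last by lra.
    apply/eqP => p12; apply: px; rewrite [p]surjective_pairing.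
    by congr pair; lra.
  have Vle : (V p <= ((m + e) * (p.2 - p.1))%:E)%E.
    apply: norm_total_variation_lipschitz => u v.
    have ap : a <= p.1 by case/andP: apx.
    have pb : p.2 <= b by case/andP: xpb.
    by move: u v ap pb; near: p.
  have leV : (`|g p.1 - g p.2|%:E <= V p)%E
    by exact: dist_le_norm_total_variation.
  have Vfin : V p \is a fin_num.
    rewrite fin_numE -ltNye -ltey (lt_le_trans (ltNyr _) leV).
    by rewrite (le_lt_trans Vle (ltry _)).
  exists (fine (V p)); first by rewrite fineK.
  exists (p.2 - p.1); first by rewrite subr_gt0.
  split; [|by rewrite -lee_fin fineK|by rewrite -lee_fin fineK].
  by move: apx xpb; near: p.
have Vpos : \forall p \near within A (nbhs (x, x)),
    exists2 r, V p = r%:E & 0 < r.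
  (* With [e = m / 2] the lower bound [(m / 2) * D] is positive, and so is the variation above
     it. *)
  have m2 : 0 < m / 2 by lra.
  apply: filterS (key _ m2 _); last by lra.
  move=> p [r Vr [D D0 [mD Dr _]]]; exists r => //.
  by apply: lt_le_trans Dr; apply: lt_le_trans mD; apply: mulr_gt0 => //; lra.
split.
  by apply: filterS Vpos => p [r Vr r0]; rewrite -/(V p) Vr eqe gt_eqF.
apply/fine_cvgP; split.
  apply: filterS Vpos => p [r Vr r0].
  by rewrite -/(V p) Vr inver gt_eqF.
apply/cvgrPdist_le => e e0.
(* The error is [(r - n) / r] with [r - n <= 2 * d * D]. The first bound on [d] gives
   [r >= (m / 2) * D]; the second gives [2 * d * D <= e * (m / 2) * D]. *)
pose d := Num.min (m / 2) (e * m / 4).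
have d0 : 0 < d by rewrite lt_min !divr_gt0// mulr_gt0.
have dm : d <= m / 2 by rewrite /d ge_min lexx.
have de : d <= e * m / 4 by rewrite /d ge_min lexx orbT.
have dltm : d < m by lra.
apply: filterS (key d d0 dltm) => p [r Vr [D D0 [mD Dr rD]]].
have n0 : 0 < `|g p.1 - g p.2|.
  by apply: lt_le_trans mD; apply: mulr_gt0 => //; lra.
have r0 : 0 < r by exact: lt_le_trans Dr.
rewrite /= -/(V p) Vr inver gt_eqF//=.
set n := `|g p.1 - g p.2| in mD Dr n0 *.
have -> : 1 - n / r = (r - n) / r by rewrite mulrBl divff// gt_eqF.
rewrite normrM normfV (gtr0_norm r0) ger0_norm ?subr_ge0// ler_pdivrMr//.
(* The products are supplied so that linear arithmetic can chain [r - n <= 2 * d * D <= e * (m / 2)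
   * D <= e * (m - d) * D <= e * r]. *)
have h1 : d * D <= (e * m / 4) * D by rewrite ler_pM2r.
have h2 : d * D <= (m / 2) * D by rewrite ler_pM2r.
have h3 : e * ((m - d) * D) <= e * r by rewrite ler_pM2l// (le_trans mD).
have h4 : e * (d * D) <= e * (m / 2 * D) by rewrite ler_pM2l.
lra.
Unshelve. all: by end_near. Qed.
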